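(* For every $n\geq1$, $\mathrm{NID}\notin\Sigma_n$ and $\mathrm{NID}\notin\Pi_n$. Equivalently, for every computable $f:\{0,1\}^*\times\{0,1\}^*\times\omega\to\mathbb{Q}$ with $\lim_{s\to\infty}f(x,y,s)=\mathrm{NID}(x,y)$ for all $x,y$, the number of oscillations (changes between nondecreasing and nonincreasing phases) of $s\mapsto f(x,y,s)$ is not bounded by any constant uniformly in $(x,y)$.
   Context: Fix a universal prefix-free machine $U$. $K$ denotes prefix-free Kolmogorov complexity and $K(x\mid y)$ conditional prefix-free complexity. For binary strings $x,y$ let $E(x,y)=\max\{K(x\mid y),K(y\mid x)\}$ and $\mathrm{NID}(x,y)=\dfrac{E(x,y)}{\max\{K(x),K(y)\}}$, a rational-valued limit-computable function. The oscillation classes: an approximation of $F$ is a computable $f$ with $\lim_{s\to\infty}f(z,s)=F(z)$ for all $z$; $F\in\Sigma_1$ if it has an approximation nondecreasing in $s$; $F\in\Pi_1$ if it has one nonincreasing in $s$; $F\in\Sigma_{n+1}$ if it has a computable approximation $f$ such that for every $z$ there is $s_z$ with $f(z,t)$ nondecreasing for $t<s_z$ and $(f(z,t))_{t\geq s_z}$ a $\Pi_n$-approximation; $F\in\Pi_{n+1}$ likewise with nonincreasing for $t<s_z$ and $(f(z,t))_{t\geq s_z}$ a $\Sigma_n$-approximation. *)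

(* Defs.v *)
(* Computability is modelled by unary partial recursive
   functions on nat (with Cantor pairing), evaluated with fuel. *)
From Stdlib Require Import Arith List QArith Qabs ZArith Cantor.
Import ListNotations.
Local Open Scope nat_scope.

Definition pr (a b : nat) : nat := Cantor.to_nat (a, b).
Definition p1 (n : nat) : nat := fst (Cantor.of_nat n).
Definition p2 (n : nat) : nat := snd (Cantor.of_nat n).

Inductive prf : Type :=
| PZero
| PSucc
| PFst
| PSnd
| PPair (f g : prf)
| PComp (f g : prf)
| PRec  (f g : prf)           (* <a,0> |-> f a ; <a,n+1> |-> g <a,<n,R(a,n)>> *)
| PMu   (f : prf).            (* x |-> least i with f <x,i> = 0, all earlier defined *)

Fixpoint eval (k : nat) (p : prf) (x : nat) {struct k} : option nat :=
  match k with
  | 0 => None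
  | S k =>
    match p with
    | PZero => Some 0
    | PSucc => Some (S x)
    | PFst => Some (p1 x)
    | PSnd => Some (p2 x)
    | PPair f g =>
        match eval k f x, eval k g x with
        | Some a, Some b => Some (pr a b)
        | _, _ => None
        end
    | PComp f g =>
        match eval k g x with
        | Some a => eval k f a
        | None => None
        end
    | PRec f g =>
        let a := p1 x in
        (fix go (n : nat) : option nat :=
           match n with
           | 0 => eval k f a
           | S m => match go m with
                    | Some r => eval k g (pr a (pr m r))
                    | None => None
                    end
           end) (p2 x)
    | PMu f =>
        (fix search (i j : nat) : option nat :=
           match j with
           | 0 => None
           | S j' => match eval k f (pr x i) with
                     | Some 0 => Some i
                     | Some _ => search (S i) j'
                     | None => None
                     end
           end) 0 (S k)
    end
  end.

Definition runs (e : prf) (x v : nat) : Prop := exists k, eval k e x = Some v.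

Definition bstr := list bool.

(* bijection {0,1}^* -> nat *)
Fixpoint scode (s : bstr) : nat :=
  match s with
  | [] => 0
  | b :: t => S (2 * scode t + (if b then 1 else 0))
  end.

Definition is_prefix (p q : bstr) : Prop := exists r, q = p ++ r.

Definition mout (m : prf) (p y x : bstr) : Prop :=
  runs m (pr (scode p) (scode y)) (scode x).

Definition halts (m : prf) (p y : bstr) : Prop :=
  exists v, runs m (pr (scode p) (scode y)) v.

Definition prefix_free (m : prf) : Prop :=
  forall y p q, halts m p y -> halts m q y -> is_prefix p q -> p = q.

Definition universal_pf (u : prf) : Prop :=
  prefix_free u /\
  forall m, prefix_free m ->
    exists c : nat, forall p y x, mout m p y x ->
      exists q, mout u q y x /\ length q <= length p + c.

Definition IsCondK (u : prf) (x y : bstr) (k : nat) : Prop :=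
  (exists p, mout u p y x /\ length p = k) /\
  (forall p, mout u p y x -> k <= length p).

Definition IsK (u : prf) (x : bstr) (k : nat) : Prop := IsCondK u x [] k.

Definition IsNID (u : prf) (x y : bstr) (q : Q) : Prop :=
  exists kxy kyx kx ky,
    IsCondK u x y kxy /\ IsCondK u y x kyx /\ IsK u x kx /\ IsK u y ky /\
    q == inject_Z (Z.of_nat (Nat.max kxy kyx)) / inject_Z (Z.of_nat (Nat.max kx ky)).

Local Open Scope Q_scope.
Definition nat_to_Z (n : nat) : Z :=
  if Nat.even n then Z.of_nat (Nat.div2 n) else (- Z.of_nat (S (Nat.div2 n)))%Z.

(* surjection nat -> Q *)
Definition decQ (v : nat) : Q := Qmake (nat_to_Z (p1 v)) (Pos.of_succ_nat (p2 v)).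

Definition computable3 (f : bstr -> bstr -> nat -> Q) : Prop :=
  exists e : prf, forall x y s, exists v,
    runs e (pr (scode x) (pr (scode y) s)) v /\ decQ v = f x y s.

Definition converges (a : nat -> Q) (l : Q) : Prop :=
  forall eps : Q, 0 < eps -> exists N, forall s, (N <= s)%nat -> Qabs (a s - l) <= eps.

Local Close Scope Q_scope.
Definition nondecr_before (a : nat -> Q) (S0 : nat) : Prop :=
  forall t t', (t <= t')%nat -> (t' < S0)%nat -> (a t <= a t')%Q.
Definition nonincr_before (a : nat -> Q) (S0 : nat) : Prop :=
  forall t t', (t <= t')%nat -> (t' < S0)%nat -> (a t' <= a t)%Q.

(* SigmaSeq n a : a is a Sigma_n-approximation (index n >= 1; n = 0 is False) *)
Fixpoint SigmaSeq (n : nat) (a : nat -> Q) {struct n} : Prop :=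
  match n with
  | 0 => False
  | S m =>
    match m with
    | 0 => forall t t', (t <= t')%nat -> (a t <= a t')%Q
    | S _ => exists s, nondecr_before a s /\ PiSeq m (fun t => a (s + t)%nat)
    end
  end
with PiSeq (n : nat) (a : nat -> Q) {struct n} : Prop :=
  match n with
  | 0 => False
  | S m =>
    match m with
    | 0 => forall t t', (t <= t')%nat -> (a t' <= a t)%Q
    | S _ => exists s, nonincr_before a s /\ SigmaSeq m (fun t => a (s + t)%nat)
    end
  end.

(* F (given by its graph R) is in Sigma_n / Pi_n *)
Definition approximates (f : bstr -> bstr -> nat -> Q) (R : bstr -> bstr -> Q -> Prop) : Prop :=
  forall x y, exists q, R x y q /\ converges (f x y) q.

Definition InSigma (n : nat) (R : bstr -> bstr -> Q -> Prop) : Prop :=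
  exists f, computable3 f /\ approximates f R /\ forall x y, SigmaSeq n (f x y).

Definition InPi (n : nat) (R : bstr -> bstr -> Q -> Prop) : Prop :=
  exists f, computable3 f /\ approximates f R /\ forall x y, PiSeq n (f x y).

(* Main.v *)
(** For a pair [x = <y,z>] the string [y] is computable from [x], so that NID(x,y) is
    K(x|y)/K(x) up to small errors. Let [f] be a computable approximation of NID. We
    keep a set of [2^a] strings [y], each with [2^b] partners [z]. A prefix-free
    machine that enumerates the set gives all its elements K(x) <= a+b and K(x|y) <= b,
    and by counting programs these bounds are nearly attained by most elements; hence
    [f(x,y,s)] is close to b/(a+b) for most of them as soon as [s] is large. Once such
    an [s] is found, the elements on which [f] has not followed are dropped and both
    [a] and [b] are shrunk, with b/(a+b) alternating between 1/2 and 1/3. Every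
    element that survives m phases forces m crossings of 5/12 upon [f].
    No knowledge of [u] is needed to run the construction. The additive constants of
    its machines are absorbed by a parameter [N], written in unary at the head of every
    program and chosen last, since all lengths are at least [20 N]. *)
Require Import Defs.
From Stdlib Require Import Arith List QArith Qabs ZArith Cantor Lia Lqa Bool FinFun.
From Stdlib Require Import ClassicalEpsilon.
Import ListNotations.
Local Open Scope nat_scope.

(** * Computable functions *)

Lemma p1_pr a b : p1 (pr a b) = a.
Proof. unfold p1, pr. now rewrite cancel_of_to. Qed.

Lemma p2_pr a b : p2 (pr a b) = b.
Proof. unfold p2, pr. now rewrite cancel_of_to. Qed.

Lemma pr_eta x : pr (p1 x) (p2 x) = x.
Proof. unfold p1, p2, pr. rewrite <- surjective_pairing. apply cancel_to_of. Qed.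

(** The anonymous fixpoints inside [eval] are restated with the evaluation of the body as a
    parameter, so that monotonicity in the fuel is proved by separate inductions. *)
Definition mu_search (h : nat -> option nat) : nat -> nat -> option nat :=
  fix search (i j : nat) :=
  match j with
  | 0 => None
  | S j' => match h i with
            | Some 0 => Some i
            | Some _ => search (S i) j'
            | None => None
            end
  end.

Definition prim_rec (z : option nat) (h : nat -> nat -> option nat) : nat -> option nat :=
  fix go (n : nat) :=
  match n with
  | 0 => z
  | S m => match go m with Some r => h m r | None => None end
  end.

Lemma eval_mu k f x :
  eval (S k) (PMu f) x = mu_search (fun i => eval k f (pr x i)) 0 (S k).
Proof. reflexivity. Qed.

Lemma eval_rec k f g x :
  eval (S k) (PRec f g) x =
  prim_rec (eval k f (p1 x)) (fun m r => eval k g (pr (p1 x) (pr m r))) (p2 x).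
Proof. reflexivity. Qed.

Lemma mu_search_mono (h h' : nat -> option nat) :
  (forall i v, h i = Some v -> h' i = Some v) ->
  forall j j' i v, j <= j' -> mu_search h i j = Some v -> mu_search h' i j' = Some v.
Proof.
  intros H; induction j as [|j IH]; intros j' i v Hj; simpl; [discriminate|].
  destruct j' as [|j']; [lia|]. simpl.
  destruct (h i) as [[|w]|] eqn:E; try discriminate; rewrite (H _ _ E); auto.
  apply IH; lia.
Qed.

Lemma prim_rec_mono z z' h h' :
  (forall v, z = Some v -> z' = Some v) ->
  (forall m r v, h m r = Some v -> h' m r = Some v) ->
  forall n v, prim_rec z h n = Some v -> prim_rec z' h' n = Some v.
Proof.
  intros Hz Hh; induction n as [|n IH]; simpl; auto. intros v.
  destruct (prim_rec z h n) as [r|]; [|discriminate].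
  rewrite (IH r eq_refl); auto.
Qed.

Lemma eval_mono k : forall k' p x v,
  k <= k' -> eval k p x = Some v -> eval k' p x = Some v.
Proof.
  induction k as [|k IH]; intros k' p x v Hk; [discriminate|].
  destruct k' as [|k']; [lia|].
  assert (IH' : forall p x v, eval k p x = Some v -> eval k' p x = Some v)
    by (intros; apply IH; auto; lia).
  destruct p; try (simpl; congruence).
  - simpl. destruct (eval k p1 x) eqn:E1; [|discriminate].
    destruct (eval k p2 x) eqn:E2; [|discriminate].
    now rewrite (IH' _ _ _ E1), (IH' _ _ _ E2).
  - simpl. destruct (eval k p2 x) eqn:E2; [|discriminate].
    rewrite (IH' _ _ _ E2). apply IH'.
  - rewrite !eval_rec. apply prim_rec_mono; intros; now apply IH'.
  - rewrite !eval_mu. apply mu_search_mono; [intros; now apply IH'|lia].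
Qed.

Lemma runs_det e x v w : runs e x v -> runs e x w -> v = w.
Proof.
  intros [k Hk] [l Hl].
  apply (eval_mono k (max k l)) in Hk; [|lia].
  apply (eval_mono l (max k l)) in Hl; [|lia]. congruence.
Qed.

Lemma runs_fst x : runs PFst x (p1 x).
Proof. now exists 1. Qed.

Lemma runs_snd x : runs PSnd x (p2 x).
Proof. now exists 1. Qed.

Lemma runs_pair f g x a b :
  runs f x a -> runs g x b -> runs (PPair f g) x (pr a b).
Proof.
  intros [k Hk] [l Hl]. exists (S (max k l)). simpl.
  now rewrite (eval_mono k (max k l) f x a), (eval_mono l (max k l) g x b) by (lia || auto).
Qed.

Lemma runs_pair_inv f g x v :
  runs (PPair f g) x v -> exists a b, runs f x a /\ runs g x b.
Proof.
  intros [[|k] Hk]; [discriminate|]. simpl in Hk.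
  destruct (eval k f x) as [a|] eqn:E1; [|discriminate].
  destruct (eval k g x) as [b|] eqn:E2; [|discriminate].
  exists a, b; split; now exists k.
Qed.

Lemma runs_comp f g x a v : runs g x a -> runs f a v -> runs (PComp f g) x v.
Proof.
  intros [k Hk] [l Hl]. exists (S (max k l)). simpl.
  rewrite (eval_mono k (max k l) g x a) by (lia || auto).
  apply (eval_mono l); auto; lia.
Qed.

Lemma runs_comp_inv f g x v :
  runs (PComp f g) x v -> exists a, runs g x a /\ runs f a v.
Proof.
  intros [[|k] Hk]; [discriminate|]. simpl in Hk.
  destruct (eval k g x) as [a|] eqn:E1; [|discriminate].
  exists a; split; now exists k.
Qed.

Lemma runs_mu_inv f x i : runs (PMu f) x i -> runs f (pr x i) 0.
Proof.
  intros [[|k] Hk]; [discriminate|]. rewrite eval_mu in Hk. exists k. revert Hk.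
  generalize 0 at 1 as i0. generalize (S k) as j.
  induction j as [|j IH]; intros i0; simpl; [discriminate|].
  destruct (eval k f (pr x i0)) as [[|w]|] eqn:E; intros H; [congruence|eauto|discriminate].
Qed.

Definition comp (f : nat -> nat) : Prop := exists e, forall x, runs e x (f x).

Lemma mu_search_hits h i n :
  (forall j, j < n -> exists w, h (i + j) = Some (S w)) -> h (i + n) = Some 0 ->
  mu_search h i (S n) = Some (i + n).
Proof.
  revert i; induction n as [|n IH]; intros i Hlt H0.
  - simpl. rewrite Nat.add_0_r in *. now rewrite H0.
  - destruct (Hlt 0) as [w Hw]; [lia|]. rewrite Nat.add_0_r in Hw.
    change (mu_search h i (S (S n))) with
      (match h i with Some 0 => Some i | Some _ => mu_search h (S i) (S n) | None => None end).
    rewrite Hw, IH.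
    + f_equal; lia.
    + intros j Hj. destruct (Hlt (S j)) as [w' Hw']; [lia|].
      exists w'. now replace (S i + j) with (i + S j) by lia.
    + now replace (S i + n) with (i + S n) by lia.
Qed.

(** Finitely many monotone requirements are met together at the maximum of their thresholds. Besides
    fuel, this covers limit stages and additive constants. *)
Lemma uniform_fuel (Q : nat -> nat -> Prop) n :
  (forall j k k', Q j k -> k <= k' -> Q j k') ->
  (forall j, j < n -> exists k, Q j k) -> exists k, forall j, j < n -> Q j k.
Proof.
  intros Hm; induction n as [|n IH]; intros H; [exists 0; lia|].
  destruct IH as [k Hk]; [intros; apply H; lia|].
  destruct (H n) as [l Hl]; [lia|].
  exists (max k l). intros j Hj. destruct (Nat.eq_dec j n) as [->|].
  - apply (Hm _ l); auto; lia.
  - apply (Hm _ k); [apply Hk|]; lia.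
Qed.

(** Unbounded search stops at the least zero, so [q] must vanish exactly where [Q] holds; a Boolean
    test is therefore negated before the search. *)
Lemma runs_mu q e (Q : nat -> bool) x :
  (forall w, runs e w (q w)) -> (forall i, q (pr x i) = 0 <-> Q i = true) ->
  (exists i, Q i = true) -> exists i, Q i = true /\ runs (PMu e) x i.
Proof.
  intros He Hq [i0 Hi0].
  assert (Hmin : exists i, Q i = true /\ forall j, j < i -> Q j = false).
  { revert i0 Hi0. induction i0 as [i0 IH] using lt_wf_ind. intros Hi0.
    destruct (existsb Q (seq 0 i0)) eqn:E.
    - apply existsb_exists in E as [j [Hj Qj]]. apply in_seq in Hj. apply (IH j); auto; lia.
    - exists i0; split; auto. intros j Hj. destruct (Q j) eqn:Qj; auto.
      assert (existsb Q (seq 0 i0) = true); [|congruence].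
      apply existsb_exists. exists j; split; auto. apply in_seq; lia. }
  destruct Hmin as [i [Hi Hlt]]. exists i; split; auto.
  destruct (uniform_fuel (fun j k => eval k e (pr x j) = Some (q (pr x j))) (S i)) as [k Hk].
  - intros j k k' H Hkk. eapply eval_mono; eauto.
  - intros j _. apply He.
  - exists (S (max k i)). rewrite eval_mu.
    assert (Hk' : forall j, j < S i -> eval (max k i) e (pr x j) = Some (q (pr x j)))
      by (intros j Hj; eapply eval_mono; [|now apply Hk]; lia).
    apply (mu_search_mono (fun j => eval (max k i) e (pr x j)) _ (fun _ _ H => H) (S i)); [lia|].
    apply (mu_search_hits _ 0); simpl.
    + intros j Hj. exists (pred (q (pr x j))). rewrite Hk' by lia.
      specialize (Hq j). rewrite (Hlt j Hj) in Hq.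
      destruct (q (pr x j)); [destruct Hq; intuition congruence|reflexivity].
    + rewrite Hk' by lia. f_equal. now apply Hq.
Qed.

(** * Closure properties of total computable functions *)

Lemma comp_ext f g : (forall x, f x = g x) -> comp f -> comp g.
Proof. intros H [e He]. exists e. intros x. rewrite <- H. apply He. Qed.

Lemma comp_zero : comp (fun _ => 0).
Proof. exists PZero. intros x. now exists 1. Qed.

Lemma comp_id : comp (fun x => x).
Proof.
  exists (PPair PFst PSnd). intros x.
  rewrite <- (pr_eta x) at 2. apply runs_pair; [apply runs_fst|apply runs_snd].
Qed.

Lemma comp_comp f g : comp f -> comp g -> comp (fun x => f (g x)).
Proof.
  intros [e He] [e' He']. exists (PComp e e'). intros x. eapply runs_comp; eauto.
Qed.

Lemma comp_S f : comp f -> comp (fun x => S (f x)).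
Proof. apply (comp_comp S). exists PSucc. intros x. now exists 1. Qed.

Lemma comp_p1 f : comp f -> comp (fun x => p1 (f x)).
Proof. apply (comp_comp p1). exists PFst. apply runs_fst. Qed.

Lemma comp_p2 f : comp f -> comp (fun x => p2 (f x)).
Proof. apply (comp_comp p2). exists PSnd. apply runs_snd. Qed.

Lemma comp_pr f g : comp f -> comp g -> comp (fun x => pr (f x) (g x)).
Proof.
  intros [e He] [e' He']. exists (PPair e e'). intros x. now apply runs_pair.
Qed.

Lemma comp_const c : comp (fun _ => c).
Proof. induction c; [apply comp_zero|now apply comp_S]. Qed.

Lemma comp_rec (f : nat -> nat) (g : nat -> nat -> nat -> nat) (h : nat -> nat) :
  comp f -> comp (fun w => g (p1 w) (p1 (p2 w)) (p2 (p2 w))) -> comp h ->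
  comp (fun x => nat_rect (fun _ => nat) (f x) (g x) (h x)).
Proof.
  intros [e He] [e' He'] Hh.
  eapply comp_ext with
    (f := fun x => (fun w => nat_rect (fun _ => nat) (f (p1 w)) (g (p1 w)) (p2 w)) (pr x (h x))).
  { intros x. simpl. now rewrite p1_pr, p2_pr. }
  apply (comp_comp (fun w => nat_rect (fun _ => nat) (f (p1 w)) (g (p1 w)) (p2 w))
    (fun x => pr x (h x))); [|apply comp_pr; auto using comp_id].
  exists (PRec e e'). intros w. unfold runs.
  assert (H : exists k, prim_rec (eval k e (p1 w))
      (fun m r => eval k e' (pr (p1 w) (pr m r))) (p2 w) =
      Some (nat_rect (fun _ => nat) (f (p1 w)) (g (p1 w)) (p2 w))).
  { induction (p2 w) as [|n IH]; simpl; [apply He|].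
    destruct IH as [k Hk].
    set (r := nat_rect _ _ _ n) in *.
    destruct (He' (pr (p1 w) (pr n r))) as [l Hl].
    rewrite !p2_pr, !p1_pr in Hl.
    exists (max k l).
    rewrite (prim_rec_mono _ _ _ _
      (fun v => eval_mono k (max k l) _ _ v (Nat.le_max_l k l))
      (fun m t v => eval_mono k (max k l) _ _ v (Nat.le_max_l k l)) n r Hk).
    eapply eval_mono; [|exact Hl]; lia. }
  destruct H as [k Hk]. exists (S k). now rewrite eval_rec.
Qed.

Definition compb (P : nat -> bool) : Prop := comp (fun x => Nat.b2n (P x)).

Lemma comp_add f g : comp f -> comp g -> comp (fun x => f x + g x).
Proof.
  intros Hf Hg.
  apply comp_ext with (f := fun x => nat_rect (fun _ => nat) (f x) (fun _ r => S r) (g x)).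
  - intros x. induction (g x); simpl; lia.
  - apply (comp_rec f (fun _ _ r => S r) g); auto.
    apply comp_S, comp_p2, comp_p2, comp_id.
Qed.

Lemma comp_mul f g : comp f -> comp g -> comp (fun x => f x * g x).
Proof.
  intros Hf Hg.
  apply comp_ext with (f := fun x => nat_rect (fun _ => nat) 0 (fun _ r => r + f x) (g x)).
  - intros x. induction (g x); simpl; lia.
  - apply (comp_rec (fun _ => 0) (fun x _ r => r + f x) g); auto using comp_zero.
    apply comp_add; [apply comp_p2, comp_p2, comp_id|].
    apply (comp_comp f); auto. apply comp_p1, comp_id.
Qed.

Lemma comp_pow2 f : comp f -> comp (fun x => 2 ^ f x).
Proof.
  intros Hf.
  apply comp_ext with (f := fun x => nat_rect (fun _ => nat) 1 (fun _ r => r + r) (f x)).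
  - intros x. induction (f x) as [|n IH]; simpl in *; lia.
  - apply (comp_rec (fun _ => 1) (fun x _ r => r + r) f); auto using comp_const.
    apply comp_add; apply comp_p2, comp_p2, comp_id.
Qed.

Lemma comp_pred f : comp f -> comp (fun x => pred (f x)).
Proof.
  intros Hf.
  apply comp_ext with (f := fun x => nat_rect (fun _ => nat) 0 (fun n _ => n) (f x)).
  - intros x. destruct (f x); reflexivity.
  - apply (comp_rec (fun _ => 0) (fun x n r => n) f); auto using comp_const.
    apply comp_p1, comp_p2, comp_id.
Qed.

Lemma comp_sub f g : comp f -> comp g -> comp (fun x => f x - g x).
Proof.
  intros Hf Hg.
  apply comp_ext with (f := fun x => nat_rect (fun _ => nat) (f x) (fun _ r => pred r) (g x)).
  - intros x. induction (g x); simpl; lia.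
  - apply (comp_rec f (fun _ _ r => pred r) g); auto.
    apply comp_pred, comp_p2, comp_p2, comp_id.
Qed.

Lemma compb_negb P : compb P -> compb (fun x => negb (P x)).
Proof.
  intros HP. apply comp_ext with (f := fun x => 1 - Nat.b2n (P x)).
  - intros x. now destruct (P x).
  - apply comp_sub; [apply comp_const|apply HP].
Qed.

Lemma compb_andb P Q : compb P -> compb Q -> compb (fun x => P x && Q x).
Proof.
  intros HP HQ. apply comp_ext with (f := fun x => Nat.b2n (P x) * Nat.b2n (Q x)).
  - intros x. now destruct (P x), (Q x).
  - now apply comp_mul.
Qed.

Lemma compb_orb P Q : compb P -> compb Q -> compb (fun x => P x || Q x).
Proof.
  intros HP HQ.
  apply comp_ext with (f := fun x => Nat.b2n (negb (negb (P x) && negb (Q x)))).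
  - intros x. now destruct (P x), (Q x).
  - now apply compb_negb, compb_andb; apply compb_negb.
Qed.

Lemma compb_leb f g : comp f -> comp g -> compb (fun x => f x <=? g x).
Proof.
  intros Hf Hg. apply comp_ext with (f := fun x => 1 - (f x - g x)).
  - intros x. destruct (Nat.leb_spec (f x) (g x)); simpl Nat.b2n; lia.
  - apply comp_sub; [apply comp_const|now apply comp_sub].
Qed.

Lemma compb_ltb f g : comp f -> comp g -> compb (fun x => f x <? g x).
Proof. intros Hf Hg. apply (compb_leb (fun x => S (f x)) g); auto. now apply comp_S. Qed.

Lemma compb_eqb f g : comp f -> comp g -> compb (fun x => f x =? g x).
Proof.
  intros Hf Hg.
  apply comp_ext with (f := fun x => Nat.b2n ((f x <=? g x) && (g x <=? f x))).
  - intros x. f_equal.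
    destruct (Nat.leb_spec (f x) (g x)), (Nat.leb_spec (g x) (f x)),
      (Nat.eqb_spec (f x) (g x)); simpl; auto; lia.
  - apply compb_andb; now apply compb_leb.
Qed.

Lemma compb_even f : comp f -> compb (fun x => Nat.even (f x)).
Proof.
  intros Hf.
  apply comp_ext with (f := fun x => nat_rect (fun _ => nat) 1 (fun _ r => 1 - r) (f x)).
  - intros x. induction (f x) as [|n IH]; auto.
    cbn [nat_rect].
    rewrite IH, Nat.even_succ, <- Nat.negb_even. now destruct (Nat.even n).
  - apply (comp_rec (fun _ => 1) (fun x _ r => 1 - r) f); auto using comp_const.
    apply comp_sub; [apply comp_const|apply comp_p2, comp_p2, comp_id].
Qed.

(** Besides counting, [cnt P n] is the rank of [n] among the elements of [P]; such ranks are the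
    indices from which programs recover elements. *)
Fixpoint cnt (P : nat -> bool) (n : nat) : nat :=
  match n with 0 => 0 | S n => cnt P n + Nat.b2n (P n) end.

Lemma comp_cnt (P : nat -> nat -> bool) h :
  compb (fun w => P (p1 w) (p2 w)) -> comp h -> comp (fun x => cnt (P x) (h x)).
Proof.
  intros HP Hh.
  apply comp_ext with
    (f := fun x => nat_rect (fun _ => nat) 0 (fun n r => r + Nat.b2n (P x n)) (h x)).
  - intros x. induction (h x); simpl; lia.
  - apply (comp_rec (fun _ => 0) (fun x n r => r + Nat.b2n (P x n)) h); auto using comp_zero.
    apply comp_add; [apply comp_p2, comp_p2, comp_id|].
    apply comp_ext with
      (f := fun x => (fun w => Nat.b2n (P (p1 w) (p2 w))) (pr (p1 x) (p1 (p2 x)))).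
    + intros x. now rewrite p1_pr, p2_pr.
    + apply (comp_comp (fun w => Nat.b2n (P (p1 w) (p2 w))) (fun x => pr (p1 x) (p1 (p2 x)))).
      * exact HP.
      * apply comp_pr; [apply comp_p1, comp_id|apply comp_p1, comp_p2, comp_id].
Qed.

Lemma comp_app2 (P : nat -> nat -> nat) f g :
  comp (fun w => P (p1 w) (p2 w)) -> comp f -> comp g -> comp (fun x => P (f x) (g x)).
Proof.
  intros HP Hf Hg.
  apply comp_ext with (f := fun x => (fun w => P (p1 w) (p2 w)) (pr (f x) (g x))).
  - intros x. now rewrite p1_pr, p2_pr.
  - apply (comp_comp (fun w => P (p1 w) (p2 w)) (fun x => pr (f x) (g x))); auto. now apply comp_pr.
Qed.

Ltac computable :=
  repeat first
    [ assumption | apply comp_const | apply comp_id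
    | apply comp_p1 | apply comp_p2 | apply comp_S | apply comp_pr | apply comp_pow2
    | apply comp_add | apply comp_mul | apply comp_sub
    | apply compb_andb | apply compb_orb | apply compb_negb
    | apply compb_ltb | apply compb_leb | apply compb_eqb | apply compb_even ].

(** * Programs indexing an enumerated set *)

Lemma scode_inj s t : scode s = scode t -> s = t.
Proof.
  revert t; induction s as [|b s IH]; intros [|c t]; cbn [scode]; try lia; auto.
  intros H. assert (b = c) as -> by (destruct b, c; auto; lia).
  f_equal. apply IH. lia.
Qed.

Lemma scode_surj n : exists s, scode s = n.
Proof.
  induction n as [n IH] using lt_wf_ind. destruct n as [|n]; [now exists []|].
  pose proof (Nat.div_mod_eq n 2). pose proof (Nat.mod_upper_bound n 2 ltac:(lia)).
  destruct (IH (n / 2)) as [t Ht]; [lia|].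
  exists ((n mod 2 =? 1) :: t). cbn [scode]. rewrite Ht.
  destruct (Nat.eqb_spec (n mod 2) 1); lia.
Qed.

Lemma scode_length s : 2 ^ length s <= S (scode s) < 2 ^ S (length s).
Proof.
  induction s as [|b s IH]; [simpl; lia|].
  cbn [length scode]. rewrite !Nat.pow_succ_r' in *. destruct b; lia.
Qed.

(** The strings of length [L] occupy the codes from [2 ^ L - 1] on, so [v + 2 ^ L - 1] with
    [v < 2 ^ L] codes the [L]-bit string of index [v]. *)
Lemma scode_length_eq s L : 2 ^ L <= S (scode s) < 2 ^ S L -> length s = L.
Proof.
  intros H. pose proof (scode_length s).
  assert (H1 : 2 ^ length s < 2 ^ S L) by lia.
  assert (H2 : 2 ^ L < 2 ^ S (length s)) by lia.
  apply Nat.pow_lt_mono_r_iff in H1, H2; lia.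
Qed.

Definition sdec (n : nat) : bstr :=
  proj1_sig (constructive_indefinite_description _ (scode_surj n)).

Lemma scode_sdec n : scode (sdec n) = n.
Proof. unfold sdec. now destruct constructive_indefinite_description. Qed.

Lemma sdec_scode s : sdec (scode s) = s.
Proof. apply scode_inj, scode_sdec. Qed.

Definition header (N : nat) (w : bstr) : bstr := repeat true N ++ false :: w.

Definition header_code (N c : nat) : nat :=
  nat_rect (fun _ => nat) (S (2 * c)) (fun _ t => S (S (2 * t))) N.

Lemma scode_header N w : scode (header N w) = header_code N (scode w).
Proof.
  unfold header_code. induction N as [|N IH]; cbn [nat_rect].
  - unfold header; cbn [repeat app scode]; lia.
  - rewrite <- IH. unfold header; cbn [repeat app scode]. lia.
Qed.

Lemma header_prefix N N' w w' :
  is_prefix (header N w) (header N' w') -> N = N' /\ is_prefix w w'.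
Proof.
  unfold header. intros [r Hr]. revert N' Hr.
  induction N as [|N IH]; intros [|N']; simpl; intros H; try discriminate.
  - injection H as H. split; auto. now exists r.
  - injection H as H. destruct (IH _ H); auto.
Qed.

Lemma prefix_same_length (w w' : bstr) : is_prefix w w' -> length w = length w' -> w = w'.
Proof.
  intros [r ->] H. rewrite length_app in H.
  destruct r; simpl in H; [now rewrite app_nil_r|lia].
Qed.

Lemma comp_header_code f g : comp f -> comp g -> comp (fun x => header_code (f x) (g x)).
Proof.
  intros Hf Hg.
  apply (comp_rec (fun x => S (2 * g x)) (fun _ _ t => S (S (2 * t))) f); computable.
Qed.

(* The index [v] is written in exactly [L N] bits behind the self-delimiting
   header [1^N 0], which makes the machine prefix-free whatever it computes. *)
Lemma index_bound u (Hu : universal_pf u) (st : prf) (L : nat -> nat) (HL : comp L)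
  (R : nat -> nat -> nat -> nat -> bool)
  (HR : compb (fun w => R (p1 (p1 (p1 w))) (p2 (p1 (p1 w))) (p2 (p1 w)) (p2 w))) :
  exists c, forall N sg y x v,
    runs st N sg -> v < 2 ^ L N -> R sg y v x = true ->
    (forall x', R sg y v x' = true -> x' = x) ->
    exists q, mout u q (sdec y) (sdec x) /\ length q <= N + 1 + L N + c.
Proof.
  (* With [w = <<p,y>,<N,v>>], the test asks whether [p] is [1^N 0] followed by the [L N]-bit string
     of index [v]. *)
  set (D := fun w => (header_code (p1 (p2 w)) (p2 (p2 w) + 2 ^ L (p1 (p2 w)) - 1) =? p1 (p1 w))
                     && (p2 (p2 w) <? 2 ^ L (p1 (p2 w)))).
  assert (HD : compb D).
  { assert (comp (fun w => 2 ^ L (p1 (p2 w)))).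
    { apply comp_pow2, (comp_comp L); computable. }
    apply compb_andb; [apply compb_eqb; [apply comp_header_code|]|]; computable. }
  apply compb_negb in HD as [d Hd]. apply compb_negb in HR as [r Hr].
  set (dec := PMu d).
  (* On [<p,y>] the machine decodes [<N,v>] from [p], computes the state [sg] from [N] by [st], and
     searches for an [x] with [R sg y v x]. *)
  set (m := PComp (PMu r)
    (PPair (PPair (PComp st (PComp PFst dec)) PSnd) (PComp PSnd dec))).
  assert (Hdec : forall p t, runs dec p t ->
    exists w, p1 p = scode (header (p1 t) w) /\ length w = L (p1 t)).
  { intros p t H. apply runs_mu_inv in H. pose proof (runs_det _ _ _ _ H (Hd _)) as E.
    unfold D in E. rewrite !p2_pr, !p1_pr in E.
    destruct (Nat.eqb_spec (header_code (p1 t) (p2 t + 2 ^ L (p1 t) - 1)) (p1 p)) as [Ep|];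
      [|discriminate].
    destruct (Nat.ltb_spec (p2 t) (2 ^ L (p1 t))); [|discriminate].
    exists (sdec (p2 t + 2 ^ L (p1 t) - 1)). rewrite scode_header, scode_sdec.
    split; [auto|]. apply scode_length_eq. rewrite scode_sdec, Nat.pow_succ_r'. lia. }
  assert (Hpf : prefix_free m).
  { assert (Hh : forall p y, halts m p y -> exists N w, p = header N w /\ length w = L N).
    { intros p y [v Hv]. apply runs_comp_inv in Hv as [t [Ht _]].
      apply runs_pair_inv in Ht as [a [b [_ Hb]]].
      apply runs_comp_inv in Hb as [t' [Ht' _]].
      apply Hdec in Ht' as [w [Hp Hw]]. rewrite p1_pr in Hp.
      exists (p1 t'), w; split; auto. now apply scode_inj. }
    intros y p q Hp Hq Hpq.
    apply Hh in Hp as [N [w [-> Hw]]]. apply Hh in Hq as [N' [w' [-> Hw']]].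
    apply header_prefix in Hpq as [<- Hww]. f_equal.
    apply prefix_same_length; congruence. }
  destruct (proj2 Hu m Hpf) as [c Hc]. exists c.
  intros N sg y x v Hst Hv HRx Huniq.
  set (w := sdec (v + 2 ^ L N - 1)).
  assert (Hw : length w = L N).
  { apply scode_length_eq. unfold w. rewrite scode_sdec, Nat.pow_succ_r'. lia. }
  destruct (Hc (header N w) (sdec y) (sdec x)) as [q [Hq Hlen]].
  - unfold mout. rewrite !scode_sdec. set (inp := pr _ y).
    destruct (runs_mu _ d (fun t => D (pr inp t)) inp Hd) as [t [Ht Hrun]].
    { intros t. destruct (D (pr inp t)); simpl; intuition congruence. }
    { exists (pr N v). unfold D, inp.
      rewrite !p2_pr, !p1_pr, scode_header. unfold w. rewrite scode_sdec, Nat.eqb_refl.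
      now apply Nat.ltb_lt. }
    (* The result of the search is only known to satisfy [D]; unique decoding identifies it. *)
    assert (Et : t = pr N v).
    { destruct (Hdec _ _ Hrun) as [w' [Ew Lw]]. unfold inp in Ew. rewrite p1_pr in Ew.
      assert (E1 : header N w = header (p1 t) w') by now apply scode_inj.
      destruct (header_prefix N (p1 t) w w') as [EN Pw].
      { exists []. now rewrite app_nil_r. }
      rewrite <- EN in Lw. apply prefix_same_length in Pw; [subst w'|congruence].
      unfold D, inp in Ht. rewrite !p2_pr, !p1_pr in Ht.
      apply andb_prop in Ht as [Ht _]. apply Nat.eqb_eq in Ht. rewrite <- EN in Ht.
      rewrite <- (scode_sdec (p2 t + 2 ^ L N - 1)), <- scode_header in Ht.
      apply scode_inj in Ht.
      destruct (header_prefix N N (sdec (p2 t + 2 ^ L N - 1)) w) as [_ Pw].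
      { exists []. now rewrite app_nil_r. }
      apply prefix_same_length in Pw.
      - apply (f_equal scode) in Pw. unfold w in Pw. rewrite !scode_sdec in Pw.
        rewrite <- (pr_eta t), <- EN. f_equal. pose proof (Nat.pow_nonzero 2 (L N)). lia.
      - apply (f_equal (@length bool)) in Ht. unfold header in Ht.
        rewrite !length_app in Ht. simpl in Ht. lia. }
    subst t.
    destruct (runs_mu _ r (fun x' => R sg y v x') (pr (pr sg y) v) Hr) as [x' [Hx' Hrun']].
    { intros x'. rewrite !p2_pr, !p1_pr, !p2_pr.
      destruct (R sg y v x'); simpl; intuition congruence. }
    { now exists x. }
    apply Huniq in Hx'. subst x'.
    eapply runs_comp; [|exact Hrun'].
    apply runs_pair; [apply runs_pair|].
    + apply runs_comp with N; auto. apply runs_comp with (pr N v); auto.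
      rewrite <- (p1_pr N v) at 2. apply runs_fst.
    + unfold inp. rewrite <- (p2_pr (scode (header N w)) y) at 2. apply runs_snd.
    + apply runs_comp with (pr N v); auto. rewrite <- (p2_pr N v) at 2. apply runs_snd.
  - exists q; split; auto. unfold header in Hlen.
    rewrite length_app, repeat_length in Hlen. simpl in Hlen. lia.
Qed.

(** * Counting *)

Lemma cnt_mono P n n' : n <= n' -> cnt P n <= cnt P n'.
Proof. induction 1; simpl; lia. Qed.

Lemma cnt_lt P n n' : P n = true -> n < n' -> cnt P n < cnt P n'.
Proof.
  intros HP Hn. pose proof (cnt_mono P (S n) n' Hn) as H.
  simpl in H. rewrite HP in H. simpl in H. lia.
Qed.

Lemma cnt_inj P n n' : P n = true -> P n' = true -> cnt P n = cnt P n' -> n = n'.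
Proof.
  intros H H' E. destruct (Nat.lt_trichotomy n n') as [Hn|[Hn|Hn]]; auto.
  - apply (cnt_lt P) in Hn; auto; lia.
  - apply (cnt_lt P) in Hn; auto; lia.
Qed.

Lemma cnt_impl P Q n : (forall x, x < n -> P x = true -> Q x = true) -> cnt P n <= cnt Q n.
Proof.
  induction n as [|n IH]; intros H; simpl; auto.
  specialize (IH ltac:(intros; apply H; auto; lia)).
  specialize (H n ltac:(lia)). destruct (P n), (Q n); simpl; intuition (lia || congruence).
Qed.

Lemma cnt_split P Q n :
  cnt P n = cnt (fun x => P x && Q x) n + cnt (fun x => P x && negb (Q x)) n.
Proof.
  induction n as [|n IH]; simpl; auto. destruct (P n), (Q n); simpl in *; lia.
Qed.

Lemma cnt_trunc P k n : cnt (fun x => P x && (cnt P x <? k)) n = min k (cnt P n).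
Proof.
  induction n as [|n IH]; simpl; [lia|]. rewrite IH.
  destruct (P n), (Nat.ltb_spec (cnt P n) k); simpl; lia.
Qed.

Lemma cnt_true n : cnt (fun _ => true) n = n.
Proof. induction n; simpl; lia. Qed.

Lemma cnt_pos P n : 0 < cnt P n -> exists x, x < n /\ P x = true.
Proof.
  induction n as [|n IH]; simpl; [lia|]. destruct (P n) eqn:E; simpl; intros H.
  - exists n; auto.
  - destruct IH as [x [Hx Px]]; [lia|]. exists x; auto.
Qed.

Lemma cnt_filter P n : cnt P n = length (filter P (seq 0 n)).
Proof.
  induction n as [|n IH]; auto. rewrite seq_S, filter_app, length_app, <- IH.
  simpl. destruct (P n); reflexivity.
Qed.

(** A name [c] belongs to at most one object, so a choice of names is injective. In the applications
    names are codes of programs. *)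
Lemma names_bound (R : nat -> nat -> Prop) B l :
  (forall x x' c, R x c -> R x' c -> x = x') -> NoDup l ->
  (forall x, In x l -> exists c, c < B /\ R x c) -> length l <= B.
Proof.
  intros HR Hl H.
  assert (G : exists l', length l' = length l /\ NoDup l' /\
    forall c, In c l' -> c < B /\ exists x, In x l /\ R x c).
  { induction Hl as [|x l Hx Hl IH].
    - exists []. split; [auto|split; [constructor|now intros c []]].
    - destruct IH as [l' [E [ND Hl']]]; [intros; apply H; now right|].
      destruct (H x) as [c [Hc HRc]]; [now left|].
      exists (c :: l'). split; [simpl; congruence|]. split.
      + constructor; auto. intros Hin. apply Hl' in Hin as [_ [x' [Hx' HRc']]].
        apply Hx. now rewrite (HR x x' c).
      + intros c' [<-|Hin]; [split; auto; exists x; split; auto; now left|].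
        apply Hl' in Hin as [? [x' [? ?]]]. split; auto. exists x'; split; auto. now right. }
  destruct G as [l' [<- [ND Hl']]]. rewrite <- (length_seq B 0) at 1.
  apply NoDup_incl_length; auto. intros c Hc. apply in_seq. apply Hl' in Hc. lia.
Qed.

Lemma cnt_names_bound (R : nat -> nat -> Prop) B P n :
  (forall x x' c, R x c -> R x' c -> x = x') ->
  (forall x, x < n -> P x = true -> exists c, c < B /\ R x c) -> cnt P n <= B.
Proof.
  intros HR H. rewrite cnt_filter. apply (names_bound R); auto.
  - apply NoDup_filter, seq_NoDup.
  - intros x Hx. apply filter_In in Hx as [Hx HP]. apply in_seq in Hx. apply H; auto; lia.
Qed.

(** Since [pr] is injective, the sections are disjoint, and each of them uses up at least [k] names
    of its own. *)
Lemma cnt_pairs_names_bound (R : nat -> nat -> Prop) B P Q n n' k :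
  (forall x x' c, R x c -> R x' c -> x = x') ->
  (forall y z, y < n -> z < n' -> P y = true -> Q y z = true ->
     exists c, c < B /\ R (pr y z) c) ->
  (forall y, y < n -> P y = true -> k <= cnt (Q y) n') ->
  cnt P n * k <= B.
Proof.
  intros HR H Hk.
  assert (G : exists l, cnt P n * k <= length l /\ NoDup l /\
     forall x, In x l -> exists y z, x = pr y z /\ y < n /\ z < n' /\ P y = true /\ Q y z = true).
  { clear H. induction n as [|n IH].
    - exists []. split; [auto|split; [constructor|now intros x []]].
    - destruct IH as [l [Hlen [ND Hl]]]; [intros; apply Hk; auto|]. simpl.
      destruct (P n) eqn:HP; simpl.
      + exists (map (pr n) (filter (Q n) (seq 0 n')) ++ l). split; [|split].
        * rewrite length_app, length_map, <- cnt_filter. specialize (Hk n ltac:(lia) HP). lia.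
        * apply NoDup_app; auto.
          -- apply Injective_map_NoDup; [|apply NoDup_filter, seq_NoDup].
             intros z z' E. apply (f_equal p2) in E. now rewrite !p2_pr in E.
          -- intros x Hx Hx'. apply in_map_iff in Hx as [z [<- _]].
             apply Hl in Hx' as [y [z' [E [Hy _]]]].
             apply (f_equal p1) in E. rewrite !p1_pr in E. lia.
        * intros x Hx. apply in_app_or in Hx as [Hx|Hx].
          -- apply in_map_iff in Hx as [z [<- Hz]]. apply filter_In in Hz as [Hz HQ].
             apply in_seq in Hz. exists n, z. repeat split; auto; lia.
          -- apply Hl in Hx as [y [z Hx]]. exists y, z. intuition.
      + exists l. split; [lia|]. split; auto.
        intros x Hx. apply Hl in Hx as [y [z Hx]]. exists y, z. intuition. }
  destruct G as [l [Hlen [ND Hl]]].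
  transitivity (length l); auto. apply (names_bound R); auto.
  intros x Hx. apply Hl in Hx as [y [z [-> Hx]]]. apply H; intuition.
Qed.

(* Markov's inequality, applied to the sections: at most half of them lose half
   of their elements to [b2], and no section loses more than a quarter to [b1]. *)
Lemma many_full_sections a b B (Y : nat -> bool) (Z b1 b2 : nat -> nat -> bool) :
  2 <= a -> 2 <= b ->
  cnt Y B = 2 ^ a ->
  (forall y, Y y = true -> cnt (Z y) B = 2 ^ b) ->
  (forall y, Y y = true -> cnt (fun z => Z y z && b1 y z) B <= 2 ^ (b - 2)) ->
  (forall P k, (forall y, P y = true -> Y y = true /\ k <= cnt (fun z => Z y z && b2 y z) B) ->
     cnt P B * k <= 2 ^ (a + b - 2)) ->
  2 ^ (a - 1) <=
    cnt (fun y => Y y &&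
           (2 ^ (b - 2) <=? cnt (fun z => Z y z && negb (b1 y z) && negb (b2 y z)) B)) B.
Proof.
  intros Ha Hb HY HZ H1 H2.
  set (poor := fun y => 2 ^ (b - 1) <=? cnt (fun z => Z y z && b2 y z) B).
  pose proof (cnt_split Y poor B) as HS.
  assert (Hpoor : cnt (fun y => Y y && poor y) B <= 2 ^ (a - 1)).
  { specialize (H2 (fun y => Y y && poor y) (2 ^ (b - 1))).
    replace (2 ^ (a + b - 2)) with (2 ^ (a - 1) * 2 ^ (b - 1)) in H2
      by (rewrite <- Nat.pow_add_r; f_equal; lia).
    apply Nat.mul_le_mono_pos_r in H2; auto.
    - pose proof (Nat.pow_nonzero 2 (b - 1)). lia.
    - intros y Hy. apply andb_prop in Hy as [? Hy]. split; auto. now apply Nat.leb_le. }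
  assert (Ea : 2 ^ a = 2 * 2 ^ (a - 1)) by (rewrite <- Nat.pow_succ_r'; f_equal; lia).
  assert (Eb : 2 ^ b = 2 * 2 ^ (b - 1)) by (rewrite <- Nat.pow_succ_r'; f_equal; lia).
  assert (Eb' : 2 ^ (b - 1) = 2 * 2 ^ (b - 2)) by (rewrite <- Nat.pow_succ_r'; f_equal; lia).
  apply Nat.le_trans with (cnt (fun y => Y y && negb (poor y)) B); [lia|].
  apply cnt_impl. intros y _ Hy. apply andb_prop in Hy as [Hy Hnp]. rewrite Hy.
  apply negb_true_iff, Nat.leb_gt in Hnp. apply Nat.leb_le.
  (* A section that is not poor keeps at least [2 ^ b - 2 ^ (b - 2) - 2 ^ (b - 1) = 2 ^ (b - 2)]
     elements. *)
  specialize (HZ y Hy). specialize (H1 y Hy).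
  rewrite (cnt_split (Z y) (b1 y)) in HZ.
  rewrite (cnt_split (fun z => Z y z && negb (b1 y z)) (b2 y)) in HZ.
  assert (cnt (fun z => Z y z && negb (b1 y z) && b2 y z) B <= cnt (fun z => Z y z && b2 y z) B).
  { apply cnt_impl. intros z _. destruct (Z y z), (b1 y z), (b2 y z); auto. }
  lia.
Qed.

(** * Alternating subsequences *)

(** The threshold [5 / 12] is the midpoint of [1 / 2] and [1 / 3], the values that NID is close to
    in even and odd phases. *)
Definition side (i : nat) (q : Q) : Prop :=
  if Nat.even i then (5 # 12 < q)%Q else (q < 5 # 12)%Q.

(* A monotone phase contains at most two consecutive terms of an alternating
   subsequence. *)
Lemma no_long_alternation n : forall (a : nat -> Q) (s : nat -> nat) i0,
  SigmaSeq n a \/ PiSeq n a ->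
  (forall i, i < 2 * n + 1 -> side (i0 + i) (a (s i))) ->
  (forall i, i < 2 * n -> s i < s (S i)) -> False.
Proof.
  induction n as [|n IH]; intros a s i0 Ha Hside Hs; [simpl in Ha; tauto|].
  assert (H01 := Hs 0 ltac:(lia)). assert (H12 := Hs 1 ltac:(lia)).
  assert (S0 := Hside 0 ltac:(lia)). assert (S1 := Hside 1 ltac:(lia)).
  assert (S2 := Hside 2 ltac:(lia)).
  rewrite Nat.add_0_r in S0. rewrite Nat.add_1_r in S1.
  replace (i0 + 2) with (S (S i0)) in S2 by lia.
  assert (Hev : forall k, Nat.even (S k) = negb (Nat.even k)).
  { intros k. now rewrite Nat.even_succ, Nat.negb_even. }
  assert (Hinc : ~ ((a (s 0%nat) <= a (s 1%nat))%Q /\ (a (s 1%nat) <= a (s 2%nat))%Q)).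
  { intros [L1 L2]. unfold side in *. rewrite !Hev in *.
    destruct (Nat.even i0); simpl in *; lra. }
  assert (Hdec : ~ ((a (s 1%nat) <= a (s 0%nat))%Q /\ (a (s 2%nat) <= a (s 1%nat))%Q)).
  { intros [L1 L2]. unfold side in *. rewrite !Hev in *.
    destruct (Nat.even i0); simpl in *; lra. }
  (* Dropping two of the [2 * n + 3] terms leaves the [2 * n + 1] terms required for [n], with the
     parity unchanged. *)
  assert (Hrec : forall t, n <> 0 -> t <= s 2 ->
    ~ (SigmaSeq n (fun k => a (t + k)) \/ PiSeq n (fun k => a (t + k)))).
  { intros t Hn Ht H.
    assert (Hge : forall i, i < 2 * n + 1 -> t <= s (S (S i))).
    { induction i as [|i IHi]; intros Hi; auto.
      specialize (IHi ltac:(lia)). specialize (Hs (S (S i)) ltac:(lia)). lia. }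
    apply (IH _ (fun i => s (S (S i)) - t) (S (S i0)) H).
    - intros i Hi. cbv beta. specialize (Hge i Hi).
      replace (t + (s (S (S i)) - t)) with (s (S (S i))) by lia.
      replace (S (S i0) + i) with (i0 + S (S i)) by lia. apply Hside. lia.
    - intros i Hi. pose proof (Hge i ltac:(lia)).
      specialize (Hs (S (S i)) ltac:(lia)). lia. }
  destruct n as [|n].
  - destruct Ha as [Ha|Ha]; simpl in Ha; [apply Hinc|apply Hdec]; split; apply Ha; lia.
  (* Either the first phase ends by [s 2], and the later phases carry the remaining terms, or it
     contains three consecutive terms, against its monotonicity. *)
  - destruct Ha as [[t [Hm Ht]]|[t [Hm Ht]]];
      destruct (Nat.le_gt_cases t (s 2)) as [Hle|Hgt].
    + apply (Hrec t); auto.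
    + apply Hinc; split; apply Hm; lia.
    + apply (Hrec t); auto.
    + apply Hdec; split; apply Hm; lia.
Qed.

(** * The construction *)

(** This is [side] on codes: an even [p1 v] stands for the numerator [p1 v / 2], so that comparison
    with [5 / 12] becomes [6 * p1 v] against [5 * S (p2 v)]; an odd [p1 v] is a negative
    numerator. *)
Definition hit (i v : nat) : bool :=
  if Nat.even i then Nat.even (p1 v) && (5 * S (p2 v) <? 6 * p1 v)
  else negb (Nat.even (p1 v)) || (6 * p1 v <? 5 * S (p2 v)).

Lemma hit_side i v : hit i v = true <-> side i (decQ v).
Proof.
  unfold hit, side, decQ, Qlt. cbn [Qnum Qden].
  rewrite Zpos_P_of_succ_nat. unfold nat_to_Z.
  pose proof (Nat.div2_odd (p1 v)) as Hd. rewrite <- Nat.negb_even in Hd.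
  destruct (Nat.even i), (Nat.even (p1 v)); simpl andb; simpl orb; simpl Nat.b2n in Hd.
  - rewrite Nat.ltb_lt. lia.
  - split; [discriminate|lia].
  - rewrite Nat.ltb_lt. lia.
  - split; auto; lia.
Qed.

Lemma compb_hit i f : comp f -> compb (fun x => hit i (f x)).
Proof. intros Hf. unfold hit. destruct (Nat.even i); computable. Qed.

(* In phase [i] of [m] there are [2 ^ ybits m i N] sections with [2 ^ zbits m i N]
   elements each, so that NID is close to 1/2 or 1/3, according to the parity of [i]. *)
Definition zbits (m i N : nat) : nat := 20 * 8 ^ (m - i) * N.
Definition ybits (m i N : nat) : nat := (if Nat.even i then 1 else 2) * zbits m i N.
(** Phase [0] uses all pairs with both coordinates below this bound, as [ybits m 0 N] equals
    [zbits m 0 N]. *)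
Definition bound (m N : nat) : nat := 2 ^ zbits m 0 N.

(* A state of phase [i] is [<..<<N, s_0>, s_1>.., s_(i-1)>]. *)
Fixpoint param (i sg : nat) : nat :=
  match i with 0 => sg | S i => param i (p1 sg) end.

(** Survival of the phases before [i]: at each recorded stage, [F x] was on the side demanded by the
    phase. *)
Fixpoint ok (F : nat -> nat -> nat) (i sg x : nat) : bool :=
  match i with
  | 0 => true
  | S i => ok F i (p1 sg) x && hit i (F x (p2 sg))
  end.

Definition good (F : nat -> nat -> nat) (m i sg y : nat) : bool :=
  2 ^ zbits m i (param i sg) <=? cnt (fun z => ok F i sg (pr y z)) (bound m (param i sg)).

Definition zrank (F : nat -> nat -> nat) (i sg x : nat) : nat :=
  cnt (fun z => ok F i sg (pr (p1 x) z)) (p2 x).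

(** The good sections are cut to the first [2 ^ ybits] ones, so that the rank of a section fits into
    [ybits] bits; [inX] cuts the sections likewise. *)
Definition inY (F : nat -> nat -> nat) (m i sg y : nat) : bool :=
  good F m i sg y && (cnt (good F m i sg) y <? 2 ^ ybits m i (param i sg)).

Definition inX (F : nat -> nat -> nat) (m i sg x : nat) : bool :=
  inY F m i sg (p1 x) && (ok F i sg x && (zrank F i sg x <? 2 ^ zbits m i (param i sg))).

Definition enough (F : nat -> nat -> nat) (m i sg : nat) : bool :=
  2 ^ ybits m i (param i sg) <=? cnt (good F m i sg) (bound m (param i sg)).

(** For [i > 0], [p2 sg] is the stage found last, so the stages increase; in phase [0] the state is
    [N] and [p2 sg] is merely some number. *)
Definition valid (F : nat -> nat -> nat) (m i sg s : nat) : bool :=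
  (p2 sg <? s) && enough F m (S i) (pr sg s).

(** * Computability of the construction *)

Lemma comp_zbits m i f : comp f -> comp (fun x => zbits m i (f x)).
Proof. intros Hf. unfold zbits. computable. Qed.

Lemma comp_ybits m i f : comp f -> comp (fun x => ybits m i (f x)).
Proof. intros Hf. unfold ybits. apply comp_mul; [apply comp_const|now apply comp_zbits]. Qed.

Lemma comp_param i f : comp f -> comp (fun x => param i (f x)).
Proof. revert f; induction i as [|i IH]; intros f Hf; simpl; auto. apply IH. computable. Qed.

Lemma compb_ok F (HF : comp (fun w => F (p1 w) (p2 w))) i f g :
  comp f -> comp g -> compb (fun x => ok F i (f x) (g x)).
Proof.
  revert f; induction i as [|i IH]; intros f Hf Hg; simpl; [exact (comp_const 1)|].
  apply compb_andb; [apply IH; computable|].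
  apply compb_hit, comp_app2; computable.
Qed.

Lemma comp_cnt_ok F (HF : comp (fun w => F (p1 w) (p2 w))) i f g h :
  comp f -> comp g -> comp h -> comp (fun x => cnt (fun z => ok F i (f x) (pr (g x) z)) (h x)).
Proof.
  intros Hf Hg Hh. apply (comp_cnt (fun x z => ok F i (f x) (pr (g x) z))); auto.
  apply compb_ok; auto.
  - apply (comp_comp f); computable.
  - apply comp_pr; [|computable]. apply (comp_comp g); computable.
Qed.

Lemma compb_good F (HF : comp (fun w => F (p1 w) (p2 w))) m i f g :
  comp f -> comp g -> compb (fun x => good F m i (f x) (g x)).
Proof.
  intros Hf Hg. unfold good, bound.
  apply compb_leb; [|apply comp_cnt_ok; auto]; apply comp_pow2, comp_zbits, comp_param; auto.
Qed.

Lemma comp_cnt_good F (HF : comp (fun w => F (p1 w) (p2 w))) m i f h :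
  comp f -> comp h -> comp (fun x => cnt (good F m i (f x)) (h x)).
Proof.
  intros Hf Hh. apply (comp_cnt (fun x y => good F m i (f x) y)); auto.
  apply compb_good; auto; [|computable]. apply (comp_comp f); computable.
Qed.

Lemma comp_zrank F (HF : comp (fun w => F (p1 w) (p2 w))) i f g :
  comp f -> comp g -> comp (fun x => zrank F i (f x) (g x)).
Proof. intros Hf Hg. unfold zrank. apply comp_cnt_ok; computable. Qed.

Lemma compb_inY F (HF : comp (fun w => F (p1 w) (p2 w))) m i f g :
  comp f -> comp g -> compb (fun x => inY F m i (f x) (g x)).
Proof.
  intros Hf Hg. unfold inY. apply compb_andb; [now apply compb_good|].
  apply compb_ltb; [now apply comp_cnt_good|]. now apply comp_pow2, comp_ybits, comp_param.
Qed.

Lemma compb_inX F (HF : comp (fun w => F (p1 w) (p2 w))) m i f g :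
  comp f -> comp g -> compb (fun x => inX F m i (f x) (g x)).
Proof.
  intros Hf Hg. unfold inX. apply compb_andb; [apply compb_inY; computable|].
  apply compb_andb; [now apply compb_ok|].
  apply compb_ltb; [now apply comp_zrank|]. now apply comp_pow2, comp_zbits, comp_param.
Qed.

Lemma compb_valid F (HF : comp (fun w => F (p1 w) (p2 w))) m i :
  compb (fun w => valid F m i (p1 w) (p2 w)).
Proof.
  unfold valid, enough, bound. apply compb_andb; [computable|].
  apply compb_leb; [|apply comp_cnt_good; auto; [computable|]];
    apply comp_pow2; [apply comp_ybits|apply comp_zbits]; apply comp_param; computable.
Qed.

(** Each phase extends the previous machine by one unbounded search for a valid stage. The machines
    do not depend on [N], so their constants are fixed before [N] is chosen. *)
Lemma stage_machines F (HF : comp (fun w => F (p1 w) (p2 w))) m :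
  exists st : nat -> prf, (forall N, runs (st 0) N N) /\
  forall i N sg, runs (st i) N sg -> (exists s, valid F m i sg s = true) ->
    exists s, valid F m i sg s = true /\ runs (st (S i)) N (pr sg s).
Proof.
  destruct comp_id as [e0 He0].
  pose (q := fun i => proj1_sig (constructive_indefinite_description _
    (compb_negb _ (compb_valid F HF m i)))).
  assert (Hq : forall i w, runs (q i) w (Nat.b2n (negb (valid F m i (p1 w) (p2 w))))).
  { intros i. unfold q. now destruct constructive_indefinite_description. }
  exists (fix st i := match i with
                      | 0 => e0
                      | S i => PPair (st i) (PComp (PMu (q i)) (st i)) end).
  split; [exact He0|]. intros i N sg Hsg Hex.
  destruct (runs_mu _ (q i) (valid F m i sg) sg (Hq i)) as [s [Hs Hrun]]; auto.
  { intros s. rewrite p1_pr, p2_pr. destruct (valid F m i sg s); simpl; intuition congruence. }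
  exists s; split; auto. apply runs_pair; auto. eapply runs_comp; eauto.
Qed.

(** With [y = p1 x] and [sdec 0] the empty string, these are upper bounds on K(x|y), K(y|x), K(x)
    and K(y), in this order. *)
Definition short_programs (u : prf) (m i N c x : nat) : Prop :=
   (exists q, mout u q (sdec (p1 x)) (sdec x) /\ length q <= N + 1 + zbits m i N + c) /\
   (exists q, mout u q (sdec x) (sdec (p1 x)) /\ length q <= N + 1 + c) /\
   (exists q, mout u q (sdec 0) (sdec x) /\
      length q <= N + 1 + (ybits m i N + zbits m i N) + c) /\
   (exists q, mout u q (sdec 0) (sdec (p1 x)) /\ length q <= N + 1 + ybits m i N + c).

(** Given [y], the rank within its section determines [x]; given [x], its projection [y] needs no
    index; without a condition, the rank of the section determines [y], and both ranks determine
    [x]. *)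
Lemma complexity_bounds u (Hu : universal_pf u) F (HF : comp (fun w => F (p1 w) (p2 w)))
  m i st :
  exists c, forall N sg x, runs st N sg -> param i sg = N -> inX F m i sg x = true ->
    short_programs u m i N c x.
Proof.
  assert (HN : forall f, comp f -> comp (fun w => 2 ^ zbits m i (param i (f w)))).
  { intros f Hf. now apply comp_pow2, comp_zbits, comp_param. }
  destruct (index_bound u Hu st (zbits m i) (comp_zbits _ _ _ comp_id)
    (fun sg y v x => (y =? p1 x) && (inX F m i sg x && (zrank F i sg x =? v))))
    as [c1 H1].
  { apply compb_andb; [computable|]. apply compb_andb; [apply compb_inX; computable|].
    apply compb_eqb; [apply comp_zrank|]; computable. }
  destruct (index_bound u Hu st (fun _ => 0) comp_zero
    (fun sg y v x => x =? p1 y)) as [c2 H2].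
  { computable. }
  (* The two ranks are packed into one number, the rank within the section being the lower digit in
     base [2 ^ zbits]. *)
  destruct (index_bound u Hu st (fun N => ybits m i N + zbits m i N)
    (comp_add _ _ (comp_ybits _ _ _ comp_id) (comp_zbits _ _ _ comp_id))
    (fun sg y v x => inX F m i sg x && (cnt (good F m i sg) (p1 x) *
        2 ^ zbits m i (param i sg) + zrank F i sg x =? v))) as [c3 H3].
  { apply compb_andb; [apply compb_inX; computable|].
    apply compb_eqb; [|computable]. apply comp_add; [|apply comp_zrank; computable].
    apply comp_mul; [|apply HN; computable]. apply comp_cnt_good; computable. }
  destruct (index_bound u Hu st (ybits m i) (comp_ybits _ _ _ comp_id)
    (fun sg y v x => inY F m i sg x && (cnt (good F m i sg) x =? v))) as [c4 H4].
  { apply compb_andb; [apply compb_inY; computable|].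
    apply compb_eqb; [apply comp_cnt_good|]; computable. }
  exists (c1 + c2 + c3 + c4). intros N sg x Hst HNs Hx.
  pose proof Hx as Hx'. unfold inX in Hx'. apply andb_prop in Hx' as [HY Hx'].
  apply andb_prop in Hx' as [Hok Hzr]. apply Nat.ltb_lt in Hzr. rewrite HNs in Hzr.
  pose proof HY as HY'. unfold inY in HY'. apply andb_prop in HY' as [Hg Hyr].
  apply Nat.ltb_lt in Hyr. rewrite HNs in Hyr.
  assert (HinX : forall x', inX F m i sg x' = true -> zrank F i sg x' = zrank F i sg x ->
    p1 x' = p1 x -> x' = x).
  { intros x' Hx' Ez Ey. rewrite <- (pr_eta x), <- (pr_eta x'), Ey. f_equal.
    unfold zrank in Ez. rewrite Ey in Ez.
    unfold inX in Hx'. apply andb_prop in Hx' as [_ Hx']. apply andb_prop in Hx' as [Hok' _].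
    apply cnt_inj in Ez; auto; [rewrite <- Ey|]; now rewrite pr_eta. }
  split; [|split; [|split]].
  - destruct (H1 N sg (p1 x) x (zrank F i sg x)) as [q [Hq Hl]]; auto.
    + rewrite Hx, !Nat.eqb_refl. reflexivity.
    + intros x' H. apply andb_prop in H as [Ey H]. apply andb_prop in H as [Hx' Ez].
      apply Nat.eqb_eq in Ey, Ez. now apply HinX.
    + exists q; split; auto; lia.
  - destruct (H2 N sg x (p1 x) 0) as [q [Hq Hl]]; auto.
    + apply Nat.eqb_refl.
    + intros x' H. now apply Nat.eqb_eq in H.
    + exists q; split; auto; lia.
  - set (M := 2 ^ zbits m i N) in *.
    destruct (H3 N sg 0 x (cnt (good F m i sg) (p1 x) * M + zrank F i sg x)) as [q [Hq Hl]]; auto.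
    + rewrite Nat.pow_add_r. fold M. nia.
    + rewrite Hx, HNs. fold M. now rewrite Nat.eqb_refl.
    + intros x' H. apply andb_prop in H as [Hx' E]. apply Nat.eqb_eq in E.
      rewrite HNs in E. fold M in E.
      assert (Hx'' := Hx'). unfold inX in Hx''. apply andb_prop in Hx'' as [HY' Hx''].
      apply andb_prop in Hx'' as [_ Hzr']. apply Nat.ltb_lt in Hzr'. rewrite HNs in Hzr'.
      fold M in Hzr'.
      assert (Ey : cnt (good F m i sg) (p1 x') = cnt (good F m i sg) (p1 x)) by nia.
      apply HinX; auto; [nia|].
      unfold inY in HY'. apply andb_prop in HY' as [Hg' _].
      now apply cnt_inj in Ey.
    + exists q; split; auto; lia.
  - destruct (H4 N sg 0 (p1 x) (cnt (good F m i sg) (p1 x))) as [q [Hq Hl]]; auto.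
    + now rewrite HY, Nat.eqb_refl.
    + intros x' H. apply andb_prop in H as [HY' E]. apply Nat.eqb_eq in E.
      unfold inY in HY'. apply andb_prop in HY' as [Hg' _].
      now apply cnt_inj in E.
    + exists q; split; auto; lia.
Qed.

(** * Oscillation of approximations *)

Lemma condK_le u x y k q : IsCondK u x y k -> mout u q y x -> k <= length q.
Proof. intros [_ H]. apply H. Qed.

(** Strings shorter than [L] have codes below [2 ^ L], so small complexity provides one of at most
    [2 ^ L] names. *)
Lemma condK_name u x y k L :
  IsCondK u x y k -> k < L -> exists c, c < 2 ^ L /\ mout u (sdec c) y x.
Proof.
  intros [[p [Hp Hk]] _] HL. exists (scode p). rewrite sdec_scode. split; auto.
  pose proof (scode_length p).
  assert (2 ^ S (length p) <= 2 ^ L) by (apply Nat.pow_le_mono_r; lia). lia.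
Qed.

Lemma condK_unique u x y k k' : IsCondK u x y k -> IsCondK u x y k' -> k = k'.
Proof.
  intros [[p [Hp Ep]] H] [[p' [Hp' Ep']] H']. apply H in Hp'. apply H' in Hp. lia.
Qed.

Lemma mout_sdec_inj u p y x x' : mout u p y (sdec x) -> mout u p y (sdec x') -> x = x'.
Proof.
  unfold mout. rewrite !scode_sdec. apply runs_det.
Qed.

(** Numerator and, below, denominator of NID(x,y) for [y = p1 x], with [kc] as conditional
    complexity and [0] as the empty condition. *)
Definition nid_num (kc : nat -> nat -> nat) (x : nat) : nat := max (kc x (p1 x)) (kc (p1 x) x).
Definition nid_den (kc : nat -> nat -> nat) (x : nat) : nat := max (kc x 0) (kc (p1 x) 0).

(** * Passing to the next phase *)

Lemma zbits_S m i N : i < m -> zbits m i N = 8 * zbits m (S i) N.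
Proof.
  intros H. unfold zbits. replace (m - i) with (S (m - S i)) by lia.
  rewrite Nat.pow_succ_r'. lia.
Qed.

Lemma zbits_ge m i N : 20 * N <= zbits m i N.
Proof. unfold zbits. pose proof (Nat.pow_nonzero 8 (m - i)). nia. Qed.

Lemma zbits_ybits m i N : zbits m i N <= ybits m i N <= 2 * zbits m i N.
Proof. unfold ybits. destruct (Nat.even i); lia. Qed.

(** Counting programs leaves at least [2 ^ (a - 1)] sections with at least [2 ^ (b - 2)] elements
    each whose complexities nearly attain the upper bounds. There NID is on the side wanted, hence
    so is [F] from some stage on, and finitely many elements have a common such stage. *)
Lemma next_stage u F m (kc : nat -> nat -> nat) N i sg c
  (Hkc : forall x y, IsCondK u (sdec x) (sdec y) (kc x y))
  (Hlim : forall x j, 0 < nid_den kc x ->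
     (if Nat.even j then 5 * nid_den kc x < 12 * nid_num kc x
      else 12 * nid_num kc x < 5 * nid_den kc x) ->
     exists s0, forall s, s0 <= s -> hit j (F x s) = true)
  (Hup : forall x, inX F m i sg x = true -> short_programs u m i N c x) :
  c <= N -> 1 <= N -> i < m -> param i sg = N -> enough F m i sg = true ->
  exists s, valid F m i sg s = true.
Proof.
  intros Hc HN Him Hpar Hen.
  assert (Hz' := zbits_S m i N Him). assert (Hz0 := zbits_ge m (S i) N).
  assert (Hzy := zbits_ybits m i N). assert (Hzy' := zbits_ybits m (S i) N).
  set (B := bound m N). set (b := zbits m i N) in *. set (a := ybits m i N) in *.
  set (Z := fun y z => ok F i sg (pr y z) && (cnt (fun z => ok F i sg (pr y z)) z <? 2 ^ b)).
  assert (HXZ : forall y z, inY F m i sg y = true -> Z y z = true -> inX F m i sg (pr y z) = true).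
  { intros y z Hy Hz. unfold inX, zrank. rewrite p1_pr, p2_pr, Hy, Hpar. exact Hz. }
  (* The two kinds of losses are K(x|y) below [b - 2] and K(x) below [a + b - 2]. *)
  assert (Hmany := many_full_sections a b B (inY F m i sg) Z
    (fun y z => kc (pr y z) y <? b - 2) (fun y z => kc (pr y z) 0 <? a + b - 2)).
  assert (HY : cnt (inY F m i sg) B = 2 ^ a).
  { unfold inY. rewrite Hpar. fold a. rewrite cnt_trunc. unfold enough in Hen.
    apply Nat.leb_le in Hen. rewrite Hpar in Hen. fold a B in Hen. lia. }
  specialize (Hmany ltac:(lia) ltac:(lia) HY).
  match type of Hmany with ?A1 -> ?A2 -> ?A3 -> _ =>
    assert (HA1 : A1); [|assert (HA2 : A2); [|assert (HA3 : A3); [|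
      specialize (Hmany HA1 HA2 HA3); clear HA1 HA2 HA3]]] end.
  { intros y Hy. unfold Z. rewrite cnt_trunc. unfold inY, good in Hy.
    apply andb_prop in Hy as [Hy _]. apply Nat.leb_le in Hy. rewrite Hpar in Hy.
    fold b B in Hy. lia. }
  { intros y Hy.
    apply (cnt_names_bound (fun z p => mout u (sdec p) (sdec y) (sdec (pr y z)))).
    - intros z z' p H H'. apply (mout_sdec_inj _ _ _ _ _ H) in H'.
      apply (f_equal p2) in H'. now rewrite !p2_pr in H'.
    - intros z _ Hz. apply andb_prop in Hz as [_ Hz]. apply Nat.ltb_lt in Hz.
      eapply condK_name; eauto. }
  { intros P k HP.
    apply (cnt_pairs_names_bound (fun x p => mout u (sdec p) (sdec 0) (sdec x)) _ P
      (fun y z => Z y z && (kc (pr y z) 0 <? a + b - 2)) B B).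
    - intros x x' p. apply mout_sdec_inj.
    - intros y z _ _ _ Hz. apply andb_prop in Hz as [_ Hz]. apply Nat.ltb_lt in Hz.
      eapply condK_name; eauto.
    - intros y _ Hy. now apply HP. }
  set (nice := fun y z => Z y z && negb (kc (pr y z) y <? b - 2)
                          && negb (kc (pr y z) 0 <? a + b - 2)) in *.
  assert (Hnice : forall y z, inY F m i sg y = true -> nice y z = true ->
    exists s0, forall s, s0 <= s -> hit i (F (pr y z) s) = true).
  { intros y z Hy Hn. unfold nice in Hn. apply andb_prop in Hn as [Hn L2].
    apply andb_prop in Hn as [Hz L1].
    apply negb_true_iff, Nat.ltb_ge in L1, L2.
    destruct (Hup _ (HXZ y z Hy Hz)) as [[q1 [M1 U1]] [[q2 [M2 U2]] [[q3 [M3 U3]] [q4 [M4 U4]]]]].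
    apply (condK_le _ _ _ _ _ (Hkc _ _)) in M1, M2, M3, M4. rewrite p1_pr in *.
    (* The upper bounds carry the error [N + 1 + c <= 2 * N + 1]; those on K(y|x) and K(y) lie below
       those on K(x|y) and K(x). *)
    assert (Hn1 : b - 2 <= nid_num kc (pr y z) <= b + 2 * N + 1).
    { unfold nid_num. rewrite p1_pr. lia. }
    assert (Hd1 : a + b - 2 <= nid_den kc (pr y z) <= a + b + 2 * N + 1).
    { unfold nid_den. rewrite p1_pr. lia. }
    (* As [b >= 160 * N], the errors cannot carry the quotient across [5 / 12], neither from
       [1 / 2], where [a = b], nor from [1 / 3], where [a = 2 * b]. *)
    apply Hlim; [lia|]. unfold a, ybits in Hd1. fold b in Hd1.
    destruct (Nat.even i); lia. }
  assert (Hunif : exists s0, forall y, y < B -> forall z, z < B ->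
    inY F m i sg y = true -> nice y z = true -> forall s, s0 <= s -> hit i (F (pr y z) s) = true).
  { apply (uniform_fuel (fun y s0 => forall z, z < B ->
      inY F m i sg y = true -> nice y z = true -> forall s, s0 <= s -> hit i (F (pr y z) s) = true)).
    - intros y k k' H Hk z Hz Hy Hn s Hs. apply H; auto; lia.
    - intros y Hy.
      apply (uniform_fuel (fun z s0 =>
        inY F m i sg y = true -> nice y z = true -> forall s, s0 <= s -> hit i (F (pr y z) s) = true)).
      + intros z k k' H Hk Hy' Hn s Hs. apply H; auto; lia.
      + intros z _. destruct (inY F m i sg y) eqn:Ey; [|exists 0; discriminate].
        destruct (nice y z) eqn:En; [|exists 0; discriminate].
        destruct (Hnice y z Ey En) as [s0 Hs0]. exists s0; auto. }
  destruct Hunif as [s0 Hs0].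
  exists (max s0 (S (p2 sg))). set (s := max s0 (S (p2 sg))).
  unfold valid. apply andb_true_intro; split; [apply Nat.ltb_lt; lia|].
  unfold enough. apply Nat.leb_le. cbn [param]. rewrite p1_pr, Hpar. fold B.
  (* The factor [8] between phases pays for the losses: the next [ybits] is at most
     [b / 4 <= a - 1], and the next [zbits] is [b / 8 <= b - 2]. *)
  transitivity (2 ^ (a - 1)); [apply Nat.pow_le_mono_r; lia|].
  etransitivity; [exact Hmany|]. apply cnt_impl.
  intros y Hy Hyn. apply andb_prop in Hyn as [HyY Hyn]. apply Nat.leb_le in Hyn.
  unfold good. apply Nat.leb_le. cbn [param]. rewrite p1_pr, Hpar. fold B.
  transitivity (2 ^ (b - 2)); [apply Nat.pow_le_mono_r; lia|].
  etransitivity; [exact Hyn|]. apply cnt_impl.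
  intros z Hz Hzn. cbn [ok]. rewrite p1_pr, p2_pr. apply andb_true_intro; split.
  - unfold nice, Z in Hzn. now destruct (ok F i sg (pr y z)).
  - apply Hs0; auto. lia.
Qed.

Lemma eventually_side (a : nat -> Q) j num den q :
  converges a q -> 0 < den ->
  (q == inject_Z (Z.of_nat num) / inject_Z (Z.of_nat den))%Q ->
  (if Nat.even j then 5 * den < 12 * num else 12 * num < 5 * den) ->
  exists s0, forall s, s0 <= s -> side j (a s).
Proof.
  intros Hcv Hden Hq Hj.
  assert (Hd : (0 < inject_Z (Z.of_nat den))%Q) by (unfold Qlt; cbn [Qnum Qden inject_Z]; lia).
  assert (Hq' : (q * inject_Z (Z.of_nat den) == inject_Z (Z.of_nat num))%Q).
  { rewrite Hq. field. lra. }
  assert (Hside : side j q).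
  { unfold side. destruct (Nat.even j).
    - apply Qnot_le_lt. intros Hle.
      apply (Qmult_le_compat_r _ _ (inject_Z (Z.of_nat den))) in Hle; [|lra].
      rewrite Hq' in Hle. unfold Qle in Hle. cbn [Qnum Qden inject_Z Qmult] in Hle. lia.
    - apply Qnot_le_lt. intros Hle.
      apply (Qmult_le_compat_r _ _ (inject_Z (Z.of_nat den))) in Hle; [|lra].
      rewrite Hq' in Hle. unfold Qle in Hle. cbn [Qnum Qden inject_Z Qmult] in Hle. lia. }
  unfold side in *. destruct (Nat.even j).
  - destruct (Hcv ((q - (5 # 12)) * (1 # 2))%Q) as [s0 Hs0]; [lra|].
    exists s0. intros s Hs. apply Hs0, Qabs_Qle_condition in Hs. lra.
  - destruct (Hcv (((5 # 12) - q) * (1 # 2))%Q) as [s0 Hs0]; [lra|].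
    exists s0. intros s Hs. apply Hs0, Qabs_Qle_condition in Hs. lra.
Qed.

Lemma enough_0 F m N : enough F m 0 N = true.
Proof.
  unfold enough. apply Nat.leb_le. cbn [param].
  transitivity (cnt (fun _ => true) (bound m N)).
  - rewrite cnt_true. unfold bound, ybits. simpl. rewrite Nat.add_0_r. auto.
  - apply cnt_impl. intros y _ _. unfold good. apply Nat.leb_le. cbn [param ok].
    rewrite cnt_true. auto.
Qed.

(** Any element surviving all [m] phases, paired with its projection, is a witness, and the recorded
    stages are the times. *)
Lemma approximation_oscillates u (Hu : universal_pf u) f
  (Hf : computable3 f) (Ha : approximates f (IsNID u)) m :
  exists x y (s : nat -> nat),
    (forall j, j < m -> side j (f x y (s j))) /\ (forall j, S j < m -> s j < s (S j)).
Proof.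
  destruct Hf as [e He].
  pose (kc := fun x y => epsilon (inhabits 0) (fun k => IsCondK u (sdec x) (sdec y) k)).
  assert (Hkc : forall x y, IsCondK u (sdec x) (sdec y) (kc x y)).
  { intros x y. apply epsilon_spec. destruct (Ha (sdec x) (sdec y)) as [q [Hq _]].
    destruct Hq as [k [? [? [? [Hk _]]]]]. now exists k. }
  (* The value is chosen classically, but it is the output of [e], so [F] is computable. *)
  pose (F := fun x s => epsilon (inhabits 0)
    (fun v => runs e (pr x (pr (p1 x) s)) v /\ decQ v = f (sdec x) (sdec (p1 x)) s)).
  assert (HFs : forall x s, runs e (pr x (pr (p1 x) s)) (F x s) /\
    decQ (F x s) = f (sdec x) (sdec (p1 x)) s).
  { intros x s. apply epsilon_spec. destruct (He (sdec x) (sdec (p1 x)) s) as [v Hv].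
    rewrite !scode_sdec in Hv. now exists v. }
  assert (HF : comp (fun w => F (p1 w) (p2 w))).
  { assert (Hi : comp (fun w => pr (p1 w) (pr (p1 (p1 w)) (p2 w)))) by computable.
    destruct Hi as [d Hd]. exists (PComp e d). intros w.
    eapply runs_comp; [apply Hd|]. apply HFs. }
  assert (Hlim : forall x j, 0 < nid_den kc x ->
     (if Nat.even j then 5 * nid_den kc x < 12 * nid_num kc x
      else 12 * nid_num kc x < 5 * nid_den kc x) ->
     exists s0, forall s, s0 <= s -> hit j (F x s) = true).
  { intros x j Hd Hj. destruct (Ha (sdec x) (sdec (p1 x))) as [q [Hq Hcv]].
    destruct Hq as [k1 [k2 [k3 [k4 [E1 [E2 [E3 [E4 Eq]]]]]]]].
    unfold IsK in E3, E4.
    assert (E0 : ([] : bstr) = sdec 0) by (apply scode_inj; now rewrite scode_sdec).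
    rewrite E0 in E3, E4.
    rewrite (condK_unique _ _ _ _ _ E1 (Hkc _ _)), (condK_unique _ _ _ _ _ E2 (Hkc _ _)),
      (condK_unique _ _ _ _ _ E3 (Hkc _ _)), (condK_unique _ _ _ _ _ E4 (Hkc _ _)) in Eq.
    destruct (eventually_side _ j (nid_num kc x) (nid_den kc x) q Hcv Hd Eq Hj) as [s0 Hs0].
    exists s0. intros s Hs. apply hit_side. rewrite (proj2 (HFs x s)). auto. }
  destruct (stage_machines F HF m) as [st [Hst0 HstS]].
  destruct (uniform_fuel (fun i c => forall N sg x,
     runs (st i) N sg -> param i sg = N -> inX F m i sg x = true ->
     short_programs u m i N c x) m) as [c Hc].
  { intros i k k' H Hk N sg x H1 H2 H3.
    destruct (H N sg x H1 H2 H3) as [[q1 [M1 U1]] [[q2 [M2 U2]] [[q3 [M3 U3]] [q4 [M4 U4]]]]].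
    split; [exists q1|split; [exists q2|split; [exists q3|exists q4]]]; split; auto; lia. }
  { intros i _. now apply complexity_bounds. }
  (* Here [c] bounds the constants of all phases independently of [N], which can thus be taken above
     it; the successor also makes [N] positive. *)
  set (N := S c).
  (* The last clause identifies the latest stage with [p2 sg], which turns the test in [valid] into
     growth of the sequence. *)
  assert (Hrun : forall i, i <= m -> exists sg (s : nat -> nat),
    runs (st i) N sg /\ param i sg = N /\ enough F m i sg = true /\
    (forall x, ok F i sg x = true -> forall j, j < i -> hit j (F x (s j)) = true) /\
    (forall j, S j < i -> s j < s (S j)) /\ (forall j, i = S j -> p2 sg = s j)).
  { induction i as [|i IH]; intros Hi.
    - exists N, (fun _ => 0). split; [apply Hst0|]. split; [reflexivity|].
      split; [apply enough_0|]. split; [intros; lia|]. split; intros; lia.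
    - destruct IH as [sg [s [Hr [Hp [Hen [Hok [Hinc Hlast]]]]]]]; [lia|].
      destruct (HstS i N sg Hr) as [t [Hv Hr']].
      { apply (next_stage u F m kc N i sg c); auto; try (unfold N; lia).
        intros x Hx. now apply (Hc i Hi N sg x). }
      unfold valid in Hv. apply andb_prop in Hv as [Hlt Hen'].
      apply Nat.ltb_lt in Hlt.
      exists (pr sg t), (fun j => if j <? i then s j else t).
      split; [exact Hr'|]. split; [cbn [param]; now rewrite p1_pr|]. split; [exact Hen'|].
      split; [|split].
      + intros x Hx j Hj. cbn [ok] in Hx. rewrite p1_pr, p2_pr in Hx.
        apply andb_prop in Hx as [Hx Hh]. destruct (Nat.ltb_spec j i); auto.
        now replace j with i by lia.
      + intros j Hj. destruct (Nat.ltb_spec j i); [|lia].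
        destruct (Nat.ltb_spec (S j) i); [auto|]. rewrite <- (Hlast j); auto; lia.
      + intros j Ej. injection Ej as <-. rewrite Nat.ltb_irrefl. apply p2_pr. }
  destruct (Hrun m (le_n m)) as [sg [s [_ [_ [Hen [Hok [Hinc _]]]]]]].
  unfold enough in Hen. apply Nat.leb_le in Hen.
  destruct (cnt_pos (good F m m sg) (bound m (param m sg))) as [y [_ Hy]].
  { pose proof (Nat.pow_nonzero 2 (ybits m m (param m sg))). lia. }
  unfold good in Hy. apply Nat.leb_le in Hy.
  destruct (cnt_pos (fun z => ok F m sg (pr y z)) (bound m (param m sg))) as [z [_ Hz]].
  { pose proof (Nat.pow_nonzero 2 (zbits m m (param m sg))). lia. }
  exists (sdec (pr y z)), (sdec (p1 (pr y z))), s. split; auto.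
  intros j Hj. rewrite <- (proj2 (HFs (pr y z) (s j))). now apply hit_side, Hok.
Qed.

Theorem mainTheorem13 :
  forall u : prf, universal_pf u ->
  forall n : nat, (1 <= n)%nat ->
    ~ InSigma n (IsNID u) /\ ~ InPi n (IsNID u).
Proof.
  intros u Hu n _.
  assert (H : forall f, computable3 f -> approximates f (IsNID u) ->
    (forall x y, SigmaSeq n (f x y) \/ PiSeq n (f x y)) -> False).
  { intros f Hf Ha Hn.
    (* An alternation of [2 * n + 1] terms is too long for [n] monotone phases. *)
    destruct (approximation_oscillates u Hu f Hf Ha (2 * n + 1)) as [x [y [s [Hs Hinc]]]].
    apply (no_long_alternation n (f x y) s 0); auto.
    intros j Hj. apply Hinc. lia. }
  split; intros [f [Hf [Ha Hn]]]; apply (H f); auto.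
Qed.
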